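(* Let $(X,\tau_X,E)$ be a soft topological space equipped with a soft action of a group $G$, and let $(X/G,\tau_\pi,E)$ be the associated soft orbit space. Then the canonical projection $(\pi,\mathrm{id}_E):(X,\tau_X,E)\to(X/G,\tau_\pi,E)$ is a soft open map.
   Context: Universes and parameter sets are non-empty sets. A soft set over $X$ with parameter set $E$ is a pair $(F,E)$ with $F:E\to\mathcal P(X)$. Soft unions and intersections are taken parameterwise; the null soft set is $e\mapsto\emptyset$ and the absolute soft set is $e\mapsto X$. A soft topology $\tau_X$ on $X$ with respect to $E$ is a family of soft sets over $X$ with parameter set $E$ containing the null and absolute soft sets and closed under arbitrary soft unions and finite soft intersections; $(X,\tau_X,E)$ is then a soft topological space and members of $\tau_X$ are called soft open. For a map $f:X\to Y$ and the identity parameter map $\mathrm{id}_E$: the soft image of $(F,E)$ is $\phi_{f,\mathrm{id}_E}(F,E)$, the soft set $e\mapsto f(F(e))$ over $Y$; the inverse soft image of $(H,E)$ is $\phi^{-1}_{f,\mathrm{id}_E}(H,E)$, the soft set $e\mapsto f^{-1}(H(e))$ over $X$. The map $(f,\mathrm{id}_E)$ between soft topological spaces is soft continuous (i.e. $f$ is soft $\mathrm{id}_E$-continuous) if inverse soft images of soft open sets are soft open, and soft open if soft images of soft open sets are soft open. A (left) soft action of a group $G$ with identity $g_0$ on $(X,\tau_X,E)$ is a map $G\times X\to X$, $(g,x)\mapsto g\cdot x$, with $g_0\cdot x=x$, $(gh)\cdot x=g\cdot(h\cdot x)$ for all $g,h\in G$, $x\in X$, and such that for each $g\in G$ the map $\alpha_g:X\to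 X$, $x\mapsto g\cdot x$, is soft $\mathrm{id}_E$-continuous. $X/G$ is the set of orbits, $\pi:X\to X/G$, $x\mapsto G\cdot x$, and the soft orbit space is $(X/G,\tau_\pi,E)$ where $\tau_\pi=\{(H,E): \phi^{-1}_{\pi,\mathrm{id}_E}(H,E)\in\tau_X\}$. *)

(* Defs.v *)
From HB Require Import structures.
From mathcomp Require Import all_boot.
From mathcomp Require Import boolp classical_sets functions cardinality.

Set Implicit Arguments.
Unset Strict Implicit.
Unset Printing Implicit Defensive.

Local Open Scope classical_set_scope.

Definition soft_set (X E : Type) : Type := E -> set X.

Section SoftSets.
Variables X Y E : Type.

Definition soft_null : soft_set X E := fun=> set0.
Definition soft_absolute : soft_set X E := fun=> setT.

Definition soft_bigcup (S : set (soft_set X E)) : soft_set X E :=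
  fun e => \bigcup_(F in S) F e.
Definition soft_bigcap (S : set (soft_set X E)) : soft_set X E :=
  fun e => \bigcap_(F in S) F e.

(* Images and inverse images along (f, id_E). *)
Definition soft_image (f : X -> Y) (F : soft_set X E) : soft_set Y E :=
  fun e => f @` F e.
Definition soft_preimage (f : X -> Y) (H : soft_set Y E) : soft_set X E :=
  fun e => f @^-1` H e.

End SoftSets.

Record softTopology (X E : Type) := SoftTopology {
  soft_open : set (soft_set X E);
  soft_open_null : soft_open (@soft_null X E);
  soft_open_absolute : soft_open (@soft_absolute X E);
  soft_open_bigcup : forall S : set (soft_set X E),
    S `<=` soft_open -> soft_open (soft_bigcup S);
  soft_open_bigcap : forall S : set (soft_set X E),
    finite_set S -> S `<=` soft_open -> soft_open (soft_bigcap S)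
}.

Section SoftMaps.
Variables X Y E : Type.
Variables (tX : softTopology X E) (tY : softTopology Y E).

Definition soft_continuous (f : X -> Y) : Prop :=
  forall H : soft_set Y E, soft_open tY H -> soft_open tX (soft_preimage f H).

Definition soft_open_map (f : X -> Y) : Prop :=
  forall F : soft_set X E, soft_open tX F -> soft_open tY (soft_image f F).

End SoftMaps.

Section SoftQuotient.
Variables (X Y E : Type) (tX : softTopology X E) (f : X -> Y).

Definition quotient_open : set (soft_set Y E) :=
  [set H | soft_open tX (soft_preimage f H)].

Fact quotient_open_null : quotient_open (@soft_null Y E).
Proof. exact: soft_open_null. Qed.

Fact quotient_open_absolute : quotient_open (@soft_absolute Y E).
Proof. exact: soft_open_absolute. Qed.

Fact quotient_open_bigcup (S : set (soft_set Y E)) :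
  S `<=` quotient_open -> quotient_open (soft_bigcup S).
Proof.
move=> SO; rewrite /quotient_open /=.
have -> : soft_preimage f (soft_bigcup S) =
          soft_bigcup [set soft_preimage f H | H in S].
  by apply/funext => e; rewrite /soft_bigcup bigcup_image -preimage_bigcup.
by apply: soft_open_bigcup => _ [H SH <-]; exact: SO.
Qed.

Fact quotient_open_bigcap (S : set (soft_set Y E)) :
  finite_set S -> S `<=` quotient_open -> quotient_open (soft_bigcap S).
Proof.
move=> finS SO; rewrite /quotient_open /=.
have -> : soft_preimage f (soft_bigcap S) =
          soft_bigcap [set soft_preimage f H | H in S].
  by apply/funext => e; rewrite /soft_bigcap bigcap_image -preimage_bigcap.
apply: soft_open_bigcap; first exact: finite_image.
by move=> _ [H SH <-]; exact: SO.
Qed.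

Definition quotient_soft_topology : softTopology Y E :=
  SoftTopology quotient_open_null quotient_open_absolute
    quotient_open_bigcup quotient_open_bigcap.

End SoftQuotient.

Record softAction (G : groupType) (X E : Type) (tX : softTopology X E) :=
  SoftAction {
    soft_act :> G -> X -> X;
    soft_act1 : forall x, soft_act 1%g x = x;
    soft_actM : forall g h x, soft_act (g * h)%g x = soft_act g (soft_act h x);
    soft_act_continuous : forall g, soft_continuous tX tX (soft_act g)
  }.

Section SoftOrbitSpace.
Variables (G : groupType) (X E : Type) (tX : softTopology X E).
Variable act : softAction G tX.

Definition soft_orbit (x : X) : set X := range (fun g : G => act g x).

(* X/G: the type whose elements are the orbits themselves, as subsets of X. *)
Definition orbit_space : Type := set_type (range soft_orbit).

Fact soft_orbit_in_range (x : X) : soft_orbit x \in range soft_orbit.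
Proof. by apply/mem_set; exists x. Qed.

Definition orbit_proj (x : X) : orbit_space :=
  exist _ (soft_orbit x) (soft_orbit_in_range x).

Definition soft_orbit_topology : softTopology orbit_space E :=
  quotient_soft_topology tX orbit_proj.

End SoftOrbitSpace.

(* Main.v *)
(** The saturation of a soft set [F] under the orbit projection is the soft union
    of its translates; the translate by [g^-1] is the inverse soft image of [F]
    under the action of [g], which is soft open by soft continuity. *)

Require Import Defs.
From HB Require Import structures.
From mathcomp Require Import all_boot.
From mathcomp Require Import boolp classical_sets functions cardinality.

Local Open Scope classical_set_scope.

(** Since [1] acts trivially, [y] lies in its own orbit; conversely, [x] and [act g x] have the same
    orbit because right multiplication by [g] permutes [G]. *)
Lemma orbit_projP (G : groupType) (X E : Type) (tX : softTopology X E)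
    (act : softAction G tX) (x y : X) :
  orbit_proj act y = orbit_proj act x <-> exists g, act g x = y.
Proof.
split=> [/(congr1 val) /= eq_orb|[g <-]].
  have : soft_orbit act y y by exists 1%g => //; exact: soft_act1.
  by rewrite eq_orb => -[g _ gx]; exists g.
apply: val_inj; apply/seteqP; split=> z [h _ <-] /=.
  by exists (h * g)%g; rewrite ?soft_actM.
by exists (h * g^-1)%g => //; rewrite -soft_actM mulgVK.
Qed.

Lemma soft_preimage_image_orbit_proj (G : groupType) (X E : Type)
    (tX : softTopology X E) (act : softAction G tX) (F : soft_set X E) :
  soft_preimage (orbit_proj act) (soft_image (orbit_proj act) F) =
  soft_bigcup (range (fun g => soft_preimage (act g) F)).
Proof.
apply/funext => e; rewrite /soft_bigcup bigcup_image.
apply/seteqP; split=> x.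
  (* The [g] carrying [x] to the point [y] of [F e] indexes the translate. *)
  by move=> [y Fy /orbit_projP[g gx]]; exists g; rewrite // /soft_preimage /= gx.
by move=> [g _ Fgx]; exists (act g x) => //; apply/orbit_projP; exists g.
Qed.

Theorem theorem5p0p7 (X E : Type) (X_nonempty : inhabited X)
    (E_nonempty : inhabited E) (tX : softTopology X E) (G : groupType)
    (act : softAction G tX) :
  soft_open_map tX (soft_orbit_topology act) (orbit_proj act).
Proof.
(* Openness in the quotient topology means that the saturation of [F] is open in [tX]. *)
move=> F openF; rewrite /= /quotient_open /= soft_preimage_image_orbit_proj.
by apply: soft_open_bigcup => _ [g _ <-]; exact: soft_act_continuous.
Qed.
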